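(* Let $G$ be an MP-digraph. Then its multipath matroid $M_G$ is isomorphic to a direct sum of uniform matroids.
   Context: Digraphs: finite, at most one edge $(v,w)$ from $v$ to $w$ for distinct $v,w$, finitely many loops allowed at each vertex. A multipath of $G$ is a spanning subgraph each connected component of which is a vertex or a simple path (a sequence of non-loop edges $e_1,\dots,e_n$ with target of $e_i$ = source of $e_{i+1}$, no repeated vertices, not closing into a cycle); $\mathrm{Mult}(G)$ is the set of multipaths identified with their edge sets and $M_G=(E(G),\mathrm{Mult}(G))$. An MP-digraph satisfies (MP1) no subgraph isomorphic to $D_A$ (vertices $v_0,v_1,v_2$, edges $(v_1,v_0),(v_0,v_2),(v_1,v_2)$) or $D_B$ (vertices $v_0,\dots,v_3$, edges $(v_0,v_1),(v_2,v_1),(v_2,v_3)$) or their edge-reversals, and (MP2) every coherently oriented cycle of length $\ge2$ is a connected component; then $M_G$ is a matroid. The uniform matroid $U_{k,n}$ has ground set $\{1,\dots,n\}$ and independent sets all subsets of size at most $k$. Direct sum: ground set the disjoint union, independents the disjoint unions of independents. *)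

(* Defs.v *)
From mathcomp Require Import all_boot.

Set Implicit Arguments.
Unset Strict Implicit.
Unset Printing Implicit Defensive.

(* Parallel edges are excluded between distinct vertices only: a vertex may
   carry any finite number of loops. *)
Record digraph := Digraph {
  vert : finType;
  edge : finType;
  src : edge -> vert;
  tgt : edge -> vert;
  edge_inj : forall e f : edge,
    src e != tgt e -> src e = src f -> tgt e = tgt f -> e = f
}.

Arguments src {d}.
Arguments tgt {d}.

Section Reversal.
Variable G : digraph.

Fact rev_edge_inj (e f : edge G) :
  tgt e != src e -> tgt e = tgt f -> src e = src f -> e = f.
Proof. by rewrite eq_sym => ne te se; apply: edge_inj. Qed.

Definition rev_digraph : digraph := Digraph rev_edge_inj.
End Reversal.

Section SimpleDigraph.
Variables (V : finType) (r : rel V).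

Fact rel_edge_inj (e f : {p : V * V | r p.1 p.2}) :
  (val e).1 != (val e).2 -> (val e).1 = (val f).1 -> (val e).2 = (val f).2 ->
  e = f.
Proof.
move=> _ h1 h2; apply: val_inj.
by rewrite [val e]surjective_pairing h1 h2 -surjective_pairing.
Qed.

Definition rel_digraph : digraph := Digraph rel_edge_inj.
End SimpleDigraph.

Definition digraph_DA : digraph :=
  rel_digraph (fun i j : 'I_3 => (val i, val j) \in [:: (1, 0); (0, 2); (1, 2)]).

Definition digraph_DB : digraph :=
  rel_digraph (fun i j : 'I_4 => (val i, val j) \in [:: (0, 1); (2, 1); (2, 3)]).

(* Subgraphs need not be induced. *)
Record subgraph (G : digraph) := Subgraph {
  vset : {set vert G};
  eset : {set edge G};
  eset_closed : forall e, e \in eset -> src e \in vset /\ tgt e \in vset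
}.

Definition isomorphic_to_subgraph (D G : digraph) (H : subgraph G) : Prop :=
  exists (f : vert D -> vert G) (g : edge D -> edge G),
    [/\ injective f, injective g, f @: setT = vset H, g @: setT = eset H
      & forall e, src (g e) = f (src e) /\ tgt (g e) = f (tgt e)].

Definition has_subgraph (D G : digraph) : Prop :=
  exists H : subgraph G, isomorphic_to_subgraph D H.

Section Multipaths.
Variable G : digraph.
Implicit Types (A : {set edge G}) (v w : vert G) (p : seq (edge G)).

(* A set of edges A stands for the spanning subgraph (vert G, A); its connected
   components are those of the underlying undirected graph. *)
Definition adjacent A : rel (vert G) := fun v w =>
  [exists e in A, ((src e == v) && (tgt e == w))
                  || ((src e == w) && (tgt e == v))].

Definition comp_vset A v : {set vert G} := [set w | connect (adjacent A) v w].

Definition comp_eset A v : {set edge G} :=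
  [set e in A | (src e \in comp_vset A v) && (tgt e \in comp_vset A v)].

Definition path_verts p : seq (vert G) :=
  if p is e :: _ then src e :: map tgt p else [::].

(* Distinctness of the whole vertex sequence, both ends included, also prevents
   the path from closing into a cycle. *)
Definition simple_path p : bool :=
  [&& p != [::],
      all (fun e => src e != tgt e) p,
      sorted (fun e f => tgt e == src f) p
    & uniq (path_verts p)].

Definition is_multipath A : Prop := forall v,
  (comp_vset A v = [set v] /\ comp_eset A v = set0) \/
  (exists p, [/\ simple_path p, comp_vset A v = [set w in path_verts p]
               & comp_eset A v = [set e in p]]).

Definition oriented_cycle p : bool :=
  [&& 2 <= size p, cycle (fun e f => tgt e == src f) p & uniq (map src p)].

(* Equality of subgraphs: in particular no vertex of the cycle carries a loop. *)
Definition is_component p : Prop :=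
  exists v, [set w in map src p] = comp_vset setT v
            /\ [set e in p] = comp_eset setT v.

Definition MP1 : Prop :=
  [/\ ~ has_subgraph digraph_DA G,
      ~ has_subgraph digraph_DB G,
      ~ has_subgraph (rev_digraph digraph_DA) G
    & ~ has_subgraph (rev_digraph digraph_DB) G].

Definition MP2 : Prop := forall p, oriented_cycle p -> is_component p.

Definition MP_digraph : Prop := MP1 /\ MP2.
End Multipaths.

Record set_system := SetSystem {
  ground : finType;
  indep : {set ground} -> Prop
}.

Definition is_matroid (M : set_system) : Prop :=
  [/\ @indep M set0,
      forall A B : {set ground M}, A \subset B -> indep B -> indep A
    & forall A B : {set ground M}, indep A -> indep B -> #|A| < #|B| ->
        exists2 x, x \in B :\: A & indep (x |: A)].

Definition isomorphic (M N : set_system) : Prop :=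
  exists f : ground M -> ground N,
    bijective f /\ forall A : {set ground M}, indep A <-> indep (f @: A).

Definition multipath_matroid (G : digraph) : set_system :=
  SetSystem (@is_multipath G).

Definition uniform_matroid (k n : nat) : set_system :=
  SetSystem (fun A : {set 'I_n} => #|A| <= k).

Definition disjoint_union (m : nat) (T : 'I_m -> finType)
    (A : forall i, {set T i}) : {set {i : 'I_m & T i}} :=
  [set u | tagged u \in A (tag u)].

Definition direct_sum (m : nat) (M : 'I_m -> set_system) : set_system :=
  SetSystem (fun S : {set {i : 'I_m & ground (M i)}} =>
    exists A : forall i, {set ground (M i)},
      (forall i, indep (A i)) /\ S = disjoint_union A).

Lemma uniform_is_matroid k n : is_matroid (uniform_matroid k n).
Proof.
split=> /= [|A B sAB|A B _ leB ltAB]; first by rewrite cards0.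
- exact/leq_trans/subset_leq_card.
have /subsetPn[x xB xA] : ~~ (B \subset A).
  by apply: contraL ltAB => /subset_leq_card; rewrite -leqNgt.
by exists x; rewrite ?inE ?xA // cardsU1 xA; apply: leq_trans leB.
Qed.

Lemma card_disjoint_union m (T : 'I_m -> finType) (A : forall i, {set T i}) :
  #|disjoint_union A| = \sum_i #|A i|.
Proof.
under eq_bigr do rewrite -sum1_card.
rewrite sig_big_dep /= -sum1_card.
by apply: eq_bigl => u; rewrite inE.
Qed.

Lemma direct_sum_is_matroid m (M : 'I_m -> set_system) :
  (forall i, is_matroid (M i)) -> is_matroid (direct_sum M).
Proof.
move=> hM; split=> /=.
- exists (fun i => set0); split; first by move=> i; case: (hM i).
  by apply/setP => u; rewrite !inE.
- move=> S T sST [B [hB defT]].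
  exists (fun i => [set x | Tagged (fun i => ground (M i)) x \in S]).
  split; last by apply/setP => -[i x]; rewrite !inE.
  move=> i; case: (hM i) => _ her _; apply: her (hB i).
  by apply/subsetP => x; rewrite inE => /(subsetP sST); rewrite defT inE.
- move=> _ _ [A [hA ->]] [B [hB ->]]; rewrite !card_disjoint_union => ltAB.
  have [i lti] : exists i, #|A i| < #|B i|.
    apply/existsP; apply: contraLR ltAB; rewrite negb_exists -leqNgt => /forallP h.
    by apply: leq_sum => i _; rewrite leqNgt.
  have [_ _ /(_ _ _ (hA i) (hB i) lti)[x]] := hM i.
  rewrite inE => /andP[xA xB] hx.
  pose S := Tagged (fun i => ground (M i)) x |: disjoint_union A.
  exists (Tagged (fun i => ground (M i)) x); first by rewrite !inE xA.
  exists (fun j => [set y | Tagged (fun i => ground (M i)) y \in S]).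
  split; last by apply/setP => -[j y]; rewrite !inE.
  move=> j; case: (eqVneq j i) => [->|neq].
    suff -> : [set y | Tagged (fun i => ground (M i)) y \in S] = x |: A i by [].
    by apply/setP => y; rewrite !inE eq_Tagged.
  suff -> : [set y | Tagged (fun i => ground (M i)) y \in S] = A j by [].
  by apply/setP => y; rewrite !inE -tag_eqE /tag_eq /= (negPf neq).
Qed.

Lemma isomorphic_is_matroid M N :
  isomorphic M N -> is_matroid N -> is_matroid M.
Proof.
move=> [f [[g fK gK] hf]] [h0 her aug].
have injf := can_inj fK; split.
- by apply/hf; rewrite imset0.
- by move=> A B sAB /hf hB; apply/hf; apply: her hB; apply: imsetS.
- move=> A B /hf hA /hf hB ltAB; have [|y] := aug _ _ hA hB.
    by rewrite !card_imset.
  rewrite inE => /andP[yA /imsetP[x xB defy]]; subst y => hx; exists x.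
    by rewrite inE xB andbT; apply: contra yA => xA; apply: imset_f.
  by apply/hf; rewrite imsetU1.
Qed.

(* Main.v *)
Require Import Defs.
From mathcomp Require Import all_boot.

Set Implicit Arguments.
Unset Strict Implicit.
Unset Printing Implicit Defensive.

(** A set of edges is a multipath iff it contains no loop, no two edges with a
    common source or a common target, and no coherently oriented cycle.  By
    (MP1), a non-loop edge cannot share its source with one non-loop edge and
    its target with another one, so "same source or same target" is an
    equivalence relation on non-loop edges; by (MP2) the cycles are components.
    Hence the edges split into the loops (rank 0), the cycles (rank one less
    than their length) and the stars (rank 1), and being a multipath is a bound
    on the number of edges taken in each of these blocks. *)

(** * Partition matroids as direct sums of uniform matroids *)

Section PartitionMatroid.
Variables (E K : finType) (c : E -> K) (k : K -> nat) (I : {set E} -> Prop).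
Hypothesis indepP :
  forall A, I A <-> forall x, #|[set e in A | c e == x]| <= k x.

Let B (i : 'I_#|K|) : {set E} := [set e | c e == enum_val i].

Let mem_block e : e \in B (enum_rank (c e)).
Proof. by rewrite inE enum_rankK. Qed.

Let U i := uniform_matroid (k (enum_val i)) #|B i|.

Let to_sum e : {i : 'I_#|K| & ground (U i)} :=
  Tagged (fun i => ground (U i)) (enum_rank_in (mem_block e) e).

Let of_sum (u : {i : 'I_#|K| & ground (U i)}) : E :=
  enum_val (tagged u : 'I_#|B (tag u)|).

Let to_sumK : cancel to_sum of_sum.
Proof. by move=> e; rewrite /of_sum /= enum_rankK_in ?mem_block. Qed.

Let of_sum_inj : injective of_sum.
Proof.
move=> [i x] [j y]; rewrite /of_sum /= => eqxy.
have := enum_valP x; have := enum_valP y; rewrite -eqxy !inE.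
move=> /eqP-> /eqP/enum_val_inj eqij; subst j.
by congr Tagged; apply: enum_val_inj.
Qed.

Let of_sumK : cancel of_sum to_sum.
Proof. by move=> u; apply: of_sum_inj; rewrite to_sumK. Qed.

(** Numbering each fibre of [c] identifies it with the ground set of a summand, and the trace of [A]
    on the fibre keeps its size, so both sides impose the same bounds. Values that [c] does not
    attain give empty summands. *)
Lemma partition_matroid_isomorphic : isomorphic (SetSystem I) (direct_sum U).
Proof.
exists to_sum; split; first by exists of_sum.
have mem_im (A : {set E}) u : (u \in to_sum @: A) = (of_sum u \in A).
  by rewrite -{1}(of_sumK u) mem_imset //; apply: can_inj to_sumK.
have block_im (A : {set E}) i :
    [set e in A | c e == enum_val i]
    = enum_val @: [set j : 'I_#|B i| | enum_val j \in A].
  apply/setP => e; rewrite inE; apply/andP/imsetP => [[eA ce]|[j]].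
    have eB : e \in B i by rewrite inE.
    by exists (enum_rank_in eB e); rewrite ?inE enum_rankK_in.
  by rewrite inE => jA ->; split=> //; have := enum_valP j; rewrite inE.
move=> A /=; split=> [/indepP hA|[F [hF defA]]]; last apply/indepP => x.
  exists (fun i => [set j : 'I_#|B i| | enum_val j \in A]); split=> [i|].
    by have := hA (enum_val i); rewrite block_im card_imset //; apply: enum_val_inj.
  by apply/setP => u; rewrite mem_im !inE.
rewrite -(enum_rankK x); set i := enum_rank x.
rewrite block_im card_imset; last exact: enum_val_inj.
suff -> : [set j : 'I_#|B i| | enum_val j \in A] = F i by apply: hF.
apply/setP => j; rewrite inE.
by have := mem_im A (Tagged (fun i => ground (U i)) j); rewrite defA inE /= => ->.
Qed.
End PartitionMatroid.

(** * Duplicate-free sequences and embedded simple digraphs *)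

Lemma map_uniq_inj_in (T1 T2 : eqType) (f : T1 -> T2) (s : seq T1) :
  uniq (map f s) -> {in s &, injective f}.
Proof.
elim: s => //= z s IHs /andP[nz uq] x y; rewrite !inE.
move=> /predU1P[->|xs] /predU1P[->|ys] //; last exact: IHs.
- by move=> eqf; rewrite eqf map_f in nz.
- by move=> eqf; rewrite -eqf map_f in nz.
Qed.

(** Duplicate-free sequences have length at most [#|T|], so the search can run over the finite type
    of bounded sequences. *)
Lemma uniq_seq_argmax (T : finType) (P : pred (seq T)) s0 :
    P s0 -> (forall s, P s -> uniq s) ->
  exists2 s, P s & forall t, P t -> size t <= size s.
Proof.
move=> Ps0 uqP.
have bd s : P s -> size s <= #|T| by move/uqP/card_uniqP <-; apply: max_card.
have Pb : P (Bseq (bd s0 Ps0)) by [].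
have [s Ps maxs] :=
  @arg_maxnP {bseq #|T| of T} _ (fun s => P s) (fun s => size s) Pb.
by exists s => // t Pt; apply: (maxs (Bseq (bd t Pt))).
Qed.

(** Only the vertices need to be placed: edges are then chosen between their images, injectively
    because an edge of [rel_digraph r] is determined by its endpoints. *)
Lemma has_subgraph_rel_digraph (V : finType) (r : rel V) (G : digraph)
    (f : V -> vert G) :
  injective f ->
  (forall i j, r i j -> [exists e, (src e == f i) && (tgt e == f j)]) ->
  has_subgraph (rel_digraph r) G.
Proof.
move=> injf hr.
have hg (e : edge (rel_digraph r)) :
    exists e', (src e' == f (src e)) && (tgt e' == f (tgt e)).
  exact/existsP/hr/(valP e).
pose g e := xchoose (hg e).
have gP e : src (g e) = f (src e) /\ tgt (g e) = f (tgt e).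
  by have /andP[/eqP-> /eqP->] := xchooseP (hg e).
have cl e : e \in g @: setT -> src e \in f @: setT /\ tgt e \in f @: setT.
  by case/imsetP => e' _ ->; have [-> ->] := gP e'; rewrite !imset_f.
exists (Subgraph cl), f, g; split=> // e e' eqg.
have [s t] := gP e; have [s' t'] := gP e'.
apply: val_inj; rewrite [val e]surjective_pairing [val e']surjective_pairing.
by congr pair; apply: injf; [rewrite -s eqg | rewrite -t eqg].
Qed.

(** * Connected components of an edge set *)

Section Components.
Variable G : digraph.
Implicit Types (A : {set edge G}) (v w : vert G) (e f : edge G).

Lemma adjacent_sym A : symmetric (adjacent A).
Proof. by move=> v w; apply: eq_existsb => e; rewrite orbC. Qed.

Lemma adjacent_edge A e : e \in A -> adjacent A (src e) (tgt e).
Proof. by move=> eA; apply/existsP; exists e; rewrite eA !eqxx. Qed.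

Lemma connect_adjacent_sym A : connect_sym (adjacent A).
Proof. exact/sym_connect_sym/adjacent_sym. Qed.

Lemma mem_comp_src A v e :
  e \in A -> (e \in comp_eset A v) = (src e \in comp_vset A v).
Proof.
move=> eA; rewrite !inE eA /=; apply: andb_idr => /connect_trans; apply.
exact/connect1/adjacent_edge.
Qed.

Lemma mem_comp_tgt A v e :
  e \in A -> (e \in comp_eset A v) = (tgt e \in comp_vset A v).
Proof.
move=> eA; rewrite !inE eA /=; apply: andb_idl => /connect_trans; apply.
by rewrite connect_adjacent_sym; apply/connect1/adjacent_edge.
Qed.

Lemma mem_comp_eset A e : e \in A -> e \in comp_eset A (src e).
Proof. by move=> eA; rewrite mem_comp_src // inE connect0. Qed.

Lemma comp_eset_eq A v e :
  e \in comp_eset A v -> comp_eset A (src e) = comp_eset A v.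
Proof.
rewrite inE => /and3P[_ + _]; rewrite inE => ve.
apply/setP => f.
by rewrite !inE !(same_connect (@connect_adjacent_sym A) ve).
Qed.
End Components.

(** * Simple paths and oriented cycles *)

Section SimplePaths.
Variable G : digraph.
Implicit Types (e f : edge G) (p q : seq (edge G)).

Let follows : rel (edge G) := fun e f => tgt e == src f.

(** [path_verts] is built from the targets; this dual reading gives access to the sources, in
    particular to their distinctness. *)
Lemma path_verts_rcons e p : path follows e p ->
  path_verts (e :: p) = rcons (map src (e :: p)) (tgt (last e p)).
Proof.
elim: p e => [|f p IHp] e //= /andP[/eqP ef] /IHp /= <-.
by rewrite ef.
Qed.

Lemma mem_path_verts_tgt p e : e \in p -> tgt e \in path_verts p.
Proof. by case: p => // f p ep; rewrite inE map_f ?orbT. Qed.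

Lemma mem_path_verts_src p e :
  simple_path p -> e \in p -> src e \in path_verts p.
Proof.
case: p => // f p /and4P[_ _ pth _] ep.
by rewrite path_verts_rcons // mem_rcons inE map_f ?orbT.
Qed.

Lemma simple_path_src_uniq p : simple_path p -> uniq (map src p).
Proof.
case: p => // f p /and4P[_ _ pth].
by rewrite path_verts_rcons // rcons_uniq => /andP[].
Qed.

Lemma simple_path_tgt_uniq p : simple_path p -> uniq (map tgt p).
Proof. by case: p => // f p /and4P[_ _ _ /andP[]]. Qed.

Lemma simple_path_uniq p : simple_path p -> uniq p.
Proof. by move/simple_path_src_uniq/map_uniq. Qed.

(** Edge number i joins vertices i and i+1 of the path. The index thus grows along edges, which
    rules out cycles inside a path. *)
Lemma index_path_verts p e : simple_path p -> e \in p ->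
  index (tgt e) (path_verts p) = (index (src e) (path_verts p)).+1.
Proof.
case: p => // f p /and4P[_ _ pth uq] ep.
have lt_ip : index e (f :: p) < size (f :: p) by rewrite index_mem.
have -> : src e = nth (src e) (path_verts (f :: p)) (index e (f :: p)).
  rewrite path_verts_rcons // nth_rcons size_map lt_ip.
  by rewrite (nth_map e) // nth_index.
have {1}-> : tgt e = nth (src e) (path_verts (f :: p)) (index e (f :: p)).+1.
  by rewrite [RHS](nth_map e) // nth_index.
by rewrite !index_uniq //= size_map // ltnW.
Qed.

Lemma oriented_cycle_nonempty p : oriented_cycle p -> exists e, e \in p.
Proof. by case: p => // e p _; exists e; rewrite mem_head. Qed.

Lemma oriented_cycle_next p e : oriented_cycle p -> e \in p ->
  next p e \in p /\ tgt e = src (next p e).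
Proof. by case/and3P => _ cyc _ ep; rewrite mem_next (eqP (next_cycle cyc ep)). Qed.

(** The target of an edge is the source of its successor, sources on the cycle are distinct, and
    [next] is injective on it. *)
Lemma oriented_cycle_tgt_inj p : oriented_cycle p -> {in p &, injective tgt}.
Proof.
move=> cp e f ep fp eqt; have /and3P[_ _ uq] := cp.
have [ep' te] := oriented_cycle_next cp ep.
have [fp' tf] := oriented_cycle_next cp fp.
have eqn : next p e = next p f.
  have injs : {in p &, injective src} by apply: map_uniq_inj_in.
  by apply: injs; rewrite // -te -tf.
by rewrite -(prev_next (map_uniq uq) e) eqn prev_next // (map_uniq uq).
Qed.

Lemma simple_path_acyclic p q :
  simple_path p -> oriented_cycle q -> ~ {subset q <= p}.
Proof.
move=> sp cq sub; have [e eq] := oriented_cycle_nonempty cq.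
(* The edge of [q] whose target comes last on [p] is followed in [q] by an edge whose target comes
   later still. *)
have [f fq maxf] := arg_maxnP (P := mem q)
  (fun f => index (tgt f) (path_verts p)) eq.
have [nq tf] := oriented_cycle_next cq fq.
by have := maxf _ nq; rewrite /= (index_path_verts sp (sub _ nq)) tf ltnn.
Qed.
End SimplePaths.

(** * Multipaths described by local conditions and acyclicity *)

Section CharacterizationOfMultipaths.
Variable G : digraph.
Implicit Types (A : {set edge G}) (v w : vert G) (e f : edge G).
Implicit Types (p q : seq (edge G)).

Let follows : rel (edge G) := fun e f => tgt e == src f.

Lemma path_comp_eset A v e p :
  path follows e p -> {subset e :: p <= A} -> e \in comp_eset A v ->
  {subset e :: p <= comp_eset A v}.
Proof.
elim: p e => [|f p IHp] e /=; first by move=> _ _ ev g; rewrite mem_seq1 => /eqP->.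
move=> /andP[/eqP ef pth] sub ev g; rewrite inE => /predU1P[->//|].
apply: IHp => // [h hp|]; first by apply: sub; rewrite inE hp orbT.
by rewrite mem_comp_src -?ef -?mem_comp_tgt // sub // !inE eqxx ?orbT.
Qed.

Lemma oriented_cycle_comp_eset A p e :
  oriented_cycle p -> {subset p <= A} -> e \in p ->
  {subset p <= comp_eset A (src e)}.
Proof.
(* Rotated to start at [e], the cycle becomes a path from [e], along which consecutive edges share a
   vertex. *)
move=> /and3P[_ cyc _] sub ep; have [i q defq] := rot_to ep.
move: cyc; rewrite -(rot_cycle i) defq /= rcons_path => /andP[pth _].
have memq f : (f \in e :: q) = (f \in p) by rewrite -defq mem_rot.
move=> f; rewrite -memq; apply: path_comp_eset => // [g|].
  by rewrite memq; apply: sub.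
exact/mem_comp_eset/sub.
Qed.

(** A description free of connected components, which can be checked block by block. *)
Definition linear_edge_set A : Prop :=
  [/\ {in A, forall e, src e != tgt e}, {in A &, injective src},
      {in A &, injective tgt}
    & forall p, oriented_cycle p -> ~ {subset p <= A}].

(** Each forbidden configuration is connected, so it would lie in one component; that component is a
    simple path, which contains none of them. *)
Lemma multipath_linear A : is_multipath A -> linear_edge_set A.
Proof.
move=> mpA; have hp e : e \in A ->
    exists2 p, simple_path p & comp_eset A (src e) = [set f in p].
  move=> eA; case: (mpA (src e)) => [[_ c0]|[p [sp _ defp]]]; last by exists p.
  by have := mem_comp_eset eA; rewrite c0 inE.
split=> [e eA|e f eA fA eqs|e f eA fA eqt|q cq sub].
- have [p /and4P[_ /allP nl _ _] defp] := hp e eA.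
  by apply: nl; have := mem_comp_eset eA; rewrite defp inE.
- have [p sp defp] := hp e eA.
  apply: (map_uniq_inj_in (simple_path_src_uniq sp)) => //.
    by have := mem_comp_eset eA; rewrite defp inE.
  by have := mem_comp_eset fA; rewrite -eqs defp inE.
- have [p sp defp] := hp e eA; have ep := mem_comp_eset eA.
  apply: (map_uniq_inj_in (simple_path_tgt_uniq sp)) => //.
    by rewrite defp inE in ep.
  (* [src f] may differ from [src e], so the component is carried from [e] to [f] through the common
     target. *)
  by move: ep; rewrite mem_comp_tgt // eqt -mem_comp_tgt // defp inE.
- have [e eq] := oriented_cycle_nonempty cq.
  have [p sp defp] := hp e (sub e eq).
  apply: (simple_path_acyclic sp cq) => f fq.
  by have := oriented_cycle_comp_eset cq sub eq fq; rewrite defp inE.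
Qed.

(* An edge of A touching a longest path of A either lies on it, or prolongs it,
   or closes it into a cycle. *)
Lemma maximal_path_closed A p :
    linear_edge_set A -> simple_path p -> {subset p <= A} ->
    (forall q, simple_path q -> {subset q <= A} ->
       {subset path_verts p <= path_verts q} -> size q <= size p) ->
  {in A, forall e, (src e \in path_verts p) || (tgt e \in path_verts p) ->
    e \in p}.
Proof.
move=> [nl injs injt acyc] sp sub maxp e eA.
have [/mapP[f fp eqf]|ntp] := boolP (tgt e \in map tgt p).
  by rewrite (injt e f) // sub.
have [/mapP[f fp eqf]|nsp] := boolP (src e \in map src p).
  by rewrite (injs e f) // sub.
case: p sp sub maxp ntp nsp => // e0 p sp sub maxp ntp nsp touch; exfalso.
have /and4P[_ nlp + uq] := sp; rewrite [sorted _ _]/= => pth.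
have defv := path_verts_rcons pth.
have subA q : {subset q <= e :: e0 :: p} -> {subset q <= A}.
  by move=> sq f /sq; rewrite inE => /predU1P[->|/sub].
(* The sources and targets of the path edges are already taken, so [e] can leave the path only from
   its last vertex and enter it only at its first. *)
have hs : src e \in path_verts (e0 :: p) -> src e = tgt (last e0 p).
  by rewrite defv mem_rcons inE (negPf nsp) orbF => /eqP.
have ht : tgt e \in path_verts (e0 :: p) -> tgt e = src e0.
  by rewrite inE (negPf ntp) orbF => /eqP.
have [sv|nsv] := boolP (src e \in path_verts (e0 :: p)); last first.
  have {touch} tv : tgt e \in path_verts (e0 :: p) by rewrite (negPf nsv) in touch.
  suff : size [:: e, e0 & p] <= size (e0 :: p) by rewrite ltnn.
  have defv' : path_verts [:: e, e0 & p] = src e :: path_verts (e0 :: p).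
    by rewrite /= (ht tv).
  apply: maxp; last first.
  - by move=> w wp; rewrite defv' inE wp orbT.
  - exact: subA.
  apply/and4P; split; rewrite // ?defv' ?cons_uniq ?nsv //.
  + by apply/andP; rewrite nl.
  + by rewrite /= (ht tv) eqxx.
have [tv|ntv] := boolP (tgt e \in path_verts (e0 :: p)).
  apply: (acyc (rcons (e0 :: p) e)); last first.
    by apply: subA => f; rewrite mem_rcons.
  apply/and3P; split; first by rewrite size_rcons.
    by rewrite /= !rcons_path pth last_rcons (hs sv) (ht tv) !eqxx.
  by rewrite map_rcons rcons_uniq nsp; apply: simple_path_src_uniq.
have defv' : path_verts (rcons (e0 :: p) e) = rcons (path_verts (e0 :: p)) (tgt e).
  by rewrite /= map_rcons.
suff : size (rcons (e0 :: p) e) <= size (e0 :: p) by rewrite size_rcons ltnn.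
apply: maxp; last first.
- by move=> w wp; rewrite defv' mem_rcons inE wp orbT.
- by apply: subA => f; rewrite mem_rcons.
apply/and4P; split=> //; first by rewrite all_rcons nl.
- by rewrite /= rcons_path pth (hs sv) eqxx.
- by rewrite defv' rcons_uniq ntv.
Qed.

(** A vertex touched by no edge of [A] is its own component. Otherwise a longest path of [A] through
    [v] is connected and its vertex set is closed under adjacency in [A], so it is the component of
    [v]. *)
Lemma linear_multipath A : linear_edge_set A -> is_multipath A.
Proof.
move=> linA v; have [nl _ _ _] := linA.
have [e /andP[eA ve]|nov] :=
    pickP [pred e in A | (src e == v) || (tgt e == v)]; last first.
  left; have nve e : e \in A -> (src e == v) || (tgt e == v) -> False.
    by move=> eA ve; have := nov e; rewrite /= eA ve.
  have cv : comp_vset A v = [set v].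
    apply/setP => w; rewrite !inE; apply/idP/eqP => [|->]; last exact: connect0.
    have cl : closed (adjacent A) (pred1 v).
      apply: (intro_closed (@connect_adjacent_sym _ A)) => x y.
      case/existsP => e /andP[/nve {}nve exy]; rewrite inE => /eqP xv.
      case: nve; rewrite -xv.
      by case/orP: exy => /andP[hx hy]; rewrite ?hx ?hy ?orbT.
    by move/(closed_connect cl); rewrite !inE eqxx => /esym/eqP.
  split=> //; apply/setP => e; rewrite in_set cv !inE.
  by apply/negP => /and3P[eA se _]; apply: (nve e eA); rewrite se.
right; pose P p := [&& simple_path p, all (mem A) p & v \in path_verts p].
have Pe : P [:: e].
  rewrite /P /simple_path /= !inE !andbT nl // eA /=.
  by rewrite ![v == _]eq_sym.
have [p /and3P[sp /allP sub vp] maxp] : exists2 p, P p & forall q, P q -> size q <= size p.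
  by apply: uniq_seq_argmax Pe _ => p /and3P[/simple_path_uniq].
have clo : {in A, forall e,
    (src e \in path_verts p) || (tgt e \in path_verts p) -> e \in p}.
  (* A competitor covering all vertices of [p] still passes through [v]. *)
  apply: (maximal_path_closed linA sp sub) => q sq subq subv; apply: maxp.
  by apply/and3P; split; [| apply/allP | apply: subv].
have cv : comp_vset A v = [set w in path_verts p].
  apply/setP => w; rewrite !inE; apply/idP/idP => [vw|wp].
    rewrite -(@closed_connect _ (adjacent A) (mem (path_verts p)) _ v) //.
    apply: (intro_closed (@connect_adjacent_sym _ A)) => x y.
    case/existsP => f /andP[fA].
    move=> /orP[] /andP[/eqP<- /eqP<-] xp.
      by apply: mem_path_verts_tgt; apply: clo; rewrite // xp.
    by apply: mem_path_verts_src => //; apply: clo; rewrite // xp orbT.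
  case: p sp sub {maxp clo} vp wp => // e0 p sp sub vp wp.
  have /and4P[_ _ pth _] := sp.
  have con x : x \in path_verts (e0 :: p) -> connect (adjacent A) (src e0) x.
    rewrite inE => /predU1P[->|/mapP[f fp ->]]; first exact: connect0.
    have /(_ _ fp) := path_comp_eset pth sub (mem_comp_eset (sub _ (mem_head _ _))).
    by rewrite !inE => /and3P[].
  apply: connect_trans (con _ wp).
  by rewrite connect_adjacent_sym con.
exists p; split=> //; apply/setP => f; rewrite [LHS]in_set cv !inE.
apply/and3P/idP => [[fA sf _]|fp]; first by apply: clo; rewrite // sf.
by split; [apply: sub | apply: mem_path_verts_src | apply: mem_path_verts_tgt].
Qed.

Lemma multipathP A : is_multipath A <-> linear_edge_set A.
Proof. by split; [apply: multipath_linear | apply: linear_multipath]. Qed.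
End CharacterizationOfMultipaths.

(** * Loops, cycles and stars of an MP-digraph *)

Section MPDigraphs.
Variable G : digraph.
Hypothesis hG : MP_digraph G.
Implicit Types (A : {set edge G}) (e f g : edge G) (p : seq (edge G)).

(** If the zigzag closes up, that is [src e = tgt g], it is a copy of [digraph_DA]; otherwise it is
    a copy of [digraph_DB]. Any other coincidence of vertices would make one of the edges a loop or
    two of them parallel. *)
Lemma no_zigzag e f g :
    src e != tgt e -> src f != tgt f -> src g != tgt g ->
    tgt e = tgt f -> src f = src g -> e != f -> f != g -> False.
Proof.
move=> nle nlf nlg tef sfg nef nfg.
have [[noDA noDB _ _] _] := hG.
have nsef : src e != src f.
  by apply: contra nef => /eqP sef; apply/eqP/edge_inj.
have ntfg : tgt f != tgt g.
  by apply: contra nfg => /eqP tfg; apply/eqP/edge_inj.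
have exe (h : edge G) v w : src h = v -> tgt h = w ->
    [exists h', (src h' == v) && (tgt h' == w)].
  by move=> <- <-; apply/existsP; exists h; rewrite !eqxx.
have [seg|nseg] := eqVneq (src e) (tgt g).
  pose s := [:: src e; src f; tgt f].
  have us : uniq s by rewrite /= !inE negb_or nsef nlf -tef nle.
  apply/noDA/(@has_subgraph_rel_digraph _ _ _ (fun i : 'I_3 => nth (src e) s i)).
    by move=> i j /eqP; rewrite nth_uniq // => /eqP/val_inj.
  move=> i j; rewrite !inE => /or3P[] /eqP[-> ->] /=.
  - exact: (exe g).
  - exact: (exe e).
  - exact: (exe f).
pose s := [:: src e; tgt f; src f; tgt g].
have us : uniq s.
  rewrite /= !inE !negb_or nsef nseg ntfg -{1}tef nle eq_sym nlf.
  by rewrite sfg nlg.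
apply/noDB/(@has_subgraph_rel_digraph _ _ _ (fun i : 'I_4 => nth (src e) s i)).
  by move=> i j /eqP; rewrite nth_uniq // => /eqP/val_inj.
move=> i j; rewrite !inE => /or3P[] /eqP[-> ->] /=.
- exact: (exe e).
- exact: (exe f).
- exact: (exe g).
Qed.

(** The edges of an oriented cycle are distinct, so bounding the length by [#|edge G|] loses no
    cycle and makes the property decidable. *)
Definition on_cycle e : bool :=
  [exists p : {bseq #|edge G| of edge G}, oriented_cycle p && (e \in p)].

Lemma on_cycleP e :
  reflect (exists2 p, oriented_cycle p & e \in p) (on_cycle e).
Proof.
apply: (iffP existsP) => [[p /andP[cp ep]]|[p cp ep]]; first by exists p.
have bd : size p <= #|edge G|.
  by have /and3P[_ _ /map_uniq/card_uniqP <-] := cp; apply: max_card.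
by exists (Bseq bd); rewrite cp.
Qed.

Lemma oriented_cycle_component p e : oriented_cycle p -> e \in p ->
  comp_eset setT (src e) = [set f in p].
Proof.
case: hG => _ mp2 cp ep; have [v [_ defp]] := mp2 p cp.
by rewrite defp; apply: comp_eset_eq; rewrite -defp inE.
Qed.

(** By (MP2) the cycle through [e] is a whole component; [f] touches it, hence lies on it, and
    sources on a cycle are distinct. *)
Lemma on_cycle_src_inj e f : on_cycle e -> src e = src f -> e = f.
Proof.
case/on_cycleP => p cp ep eqs; have defp := oriented_cycle_component cp ep.
have /and3P[_ _ uq] := cp; apply: (map_uniq_inj_in uq) => //.
by have := mem_comp_eset (in_setT f); rewrite -eqs defp inE.
Qed.

Lemma on_cycle_tgt_inj e f : on_cycle e -> tgt e = tgt f -> e = f.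
Proof.
case/on_cycleP => p cp ep eqt; have defp := oriented_cycle_component cp ep.
apply: (oriented_cycle_tgt_inj cp) => //.
have := mem_comp_eset (in_setT e).
by rewrite mem_comp_tgt ?in_setT // eqt -mem_comp_tgt ?in_setT // defp inE.
Qed.

Definition star e : {set edge G} :=
  [set f | (src f != tgt f) && ((src f == src e) || (tgt f == tgt e))].

(** For distinct [e] and [f], a non-loop edge sharing its target with one of them, but not their
    common source, would form a zigzag with them. *)
Lemma star_eq_src e f : src e != tgt e -> src f != tgt f -> src e = src f ->
  star e = star f.
Proof.
move=> nle nlf eqs; have [->//|nef] := eqVneq e f.
apply/setP => g; rewrite !inE eqs; have [nlg|//] := boolP (src g != tgt g).
have [//|nsg] := eqVneq (src g) (src f); rewrite /=.
have nge : tgt g != tgt e.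
  apply/eqP => tge; apply: (@no_zigzag g e f) => //.
  by apply: contraNneq nsg => ->; rewrite eqs.
have ngf : tgt g != tgt f.
  apply/eqP => tgf; apply: (@no_zigzag g f e) => //; last by rewrite eq_sym.
  by apply: contraNneq nsg => ->.
by rewrite (negPf nge) (negPf ngf).
Qed.

Lemma star_eq_tgt e f : src e != tgt e -> src f != tgt f -> tgt e = tgt f ->
  star e = star f.
Proof.
move=> nle nlf eqt; have [->//|nef] := eqVneq e f.
apply/setP => g; rewrite !inE eqt; have [nlg|//] := boolP (src g != tgt g).
have [//|ntg] := eqVneq (tgt g) (tgt f); rewrite ?orbT //= !orbF.
have nge : src g != src e.
  apply/eqP => sge; apply: (@no_zigzag f e g) => //; first by rewrite eq_sym.
  by apply: contraNneq ntg => <-; rewrite eqt.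
have ngf : src g != src f.
  apply/eqP => sgf; apply: (@no_zigzag e f g) => //.
  by apply: contraNneq ntg => <-.
by rewrite (negPf nge) (negPf ngf).
Qed.

(** Non-loop edges are labelled by the edge set of their block, all loops share [None], and the tags
    [inl] and [inr] let the rank be read off the label. *)
Definition block e : option ({set edge G} + {set edge G}) :=
  if src e == tgt e then None
  else Some (if on_cycle e then inl (comp_eset setT (src e)) else inr (star e)).

Definition block_rank (x : option ({set edge G} + {set edge G})) : nat :=
  match x with None => 0 | Some (inl C) => #|C|.-1 | Some (inr _) => 1 end.

Variant block_spec e : option ({set edge G} + {set edge G}) -> Prop :=
  | LoopBlock of src e = tgt e : block_spec e None
  | CycleBlock p of src e != tgt e & oriented_cycle p & e \in p :
      block_spec e (Some (inl [set f in p]))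
  | StarBlock of src e != tgt e & ~~ on_cycle e :
      block_spec e (Some (inr (star e))).

Lemma blockP e : block_spec e (block e).
Proof.
rewrite /block; have [loop|nl] := eqVneq; first exact: LoopBlock.
have [/on_cycleP[p cp ep]|nc] := boolP (on_cycle e); last exact: StarBlock.
by rewrite (oriented_cycle_component cp ep); apply: CycleBlock.
Qed.

(** The block [None] holds only loops, which [A] avoids; [A] cannot contain a whole cycle; and two
    edges of one star share a source or a target, hence are equal if both lie in [A]. *)
Lemma linear_block_bound A : linear_edge_set A ->
  forall x, #|[set e in A | block e == x]| <= block_rank x.
Proof.
move=> [nl injs injt acyc] x; set S := [set e in A | _].
have [->|[e]] := set_0Vmem S; first by rewrite cards0.
rewrite inE => /andP[eA /eqP defx].
case: (blockP e) defx => [loop|p nle cp ep|nle nce] defx.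
- by have := nl e eA; rewrite loop eqxx.
- have ltA : A :&: [set f in p] \proper [set f in p].
    rewrite properEneq subsetIr andbT; apply/eqP => /setIidPr sub.
    by apply: (acyc p cp) => f fp; apply: (subsetP sub); rewrite inE.
  (* The cycle is nonempty, so the bound by the predecessor of its length amounts to a strict
     inequality. *)
  rewrite -defx /= -ltnS prednK; last first.
    by rewrite card_gt0; apply/set0Pn; exists e; rewrite inE.
  apply: leq_ltn_trans (proper_card ltA).
  apply/subset_leq_card/subsetP => f; rewrite inE -defx => /andP[fA].
  case: blockP => // q _ _ fq /eqP[eqpq].
  by rewrite -eqpq !inE fA.
- rewrite -defx /=; apply/card_le1_eqP => f g; rewrite !inE -defx.
  move=> /andP[fA bf] /andP[gA bg].
  have {bf} sf : star f = star e by case: blockP bf => // _ _ /eqP[].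
  have {bg} sg : star g = star e by case: blockP bg => // _ _ /eqP[].
  (* As [g] lies in its own star, the equality of stars makes [f] and [g] share a source or a
     target. *)
  have : g \in star f by rewrite sf -sg inE nl ?eqxx.
  by rewrite inE => /andP[_ /orP[] /eqP]; [apply: injs | apply: injt].
Qed.

(** Each violation overfills a block: a loop the block of rank 0, two edges off the cycles with a
    common source or target a star, an entire cycle its own block. If one of two such edges is on a
    cycle, (MP2) already makes them equal. *)
Lemma block_bound_linear A :
  (forall x, #|[set e in A | block e == x]| <= block_rank x) ->
  linear_edge_set A.
Proof.
move=> bd; have nl : {in A, forall e, src e != tgt e}.
  move=> e eA; apply/eqP => loop; have := bd None; rewrite /= leqn0 cards_eq0.
  by move/eqP/setP/(_ e); rewrite !inE eA /block loop eqxx.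
have star_inj e f : e \in A -> f \in A -> ~~ on_cycle e -> ~~ on_cycle f ->
    star e = star f -> e = f.
  move=> eA fA nce ncf eqst; have /card_le1_eqP := bd (Some (inr (star e))).
  apply; rewrite inE /block.
    by rewrite fA (negPf (nl f fA)) (negPf ncf) eqst /=.
  by rewrite eA (negPf (nl e eA)) (negPf nce) /=.
split=> // [e f eA fA eqs|e f eA fA eqt|p cp sub].
- have [ce|nce] := boolP (on_cycle e); first exact: on_cycle_src_inj.
  have [cf|ncf] := boolP (on_cycle f); first exact/esym/on_cycle_src_inj.
  by apply: star_inj => //; apply: star_eq_src; rewrite ?nl.
- have [ce|nce] := boolP (on_cycle e); first exact: on_cycle_tgt_inj.
  have [cf|ncf] := boolP (on_cycle f); first exact/esym/on_cycle_tgt_inj.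
  by apply: star_inj => //; apply: star_eq_tgt; rewrite ?nl.
have [e ep] := oriented_cycle_nonempty cp.
have p_gt0 : 0 < #|[set f in p]|.
  by rewrite card_gt0; apply/set0Pn; exists e; rewrite inE.
have := bd (Some (inl [set f in p])); rewrite /= leqNgt => /negP[].
rewrite prednK //; apply/subset_leq_card/subsetP => f; rewrite !inE => fp.
rewrite (sub f fp) /block (negPf (nl f (sub f fp))).
have -> : on_cycle f by apply/on_cycleP; exists p.
by rewrite (oriented_cycle_component cp fp) eqxx.
Qed.

Lemma multipath_blockP A :
  is_multipath A <-> forall x, #|[set e in A | block e == x]| <= block_rank x.
Proof.
split=> [/multipathP/linear_block_bound //|bd].
exact/multipathP/block_bound_linear.
Qed.
End MPDigraphs.

Theorem theorem4p24 (G : digraph) (hG : MP_digraph G) :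
  exists (m : nat) (k n : 'I_m -> nat),
    isomorphic (multipath_matroid G)
               (direct_sum (fun i : 'I_m => uniform_matroid (k i) (n i))).
Proof.
(* Here [m] counts all possible labels, [k] is the [block_rank] of a label and [n] the number of
   edges carrying it. *)
by do 3 eexists; exact: (partition_matroid_isomorphic (multipath_blockP hG)).
Qed.
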